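(* Let $I$ be an isotropic distribution of vector fields on $(M,g)$ and let $\hat{\nabla}$ be any spinorial connection. Then $I$ is integrable if and only if $X\cdot\hat{\nabla}_Y\hat{\varphi}= Y\cdot\hat{\nabla}_X\hat{\varphi}$ for all vector fields $X,Y$ in $I$ and all spinor fields $\hat{\varphi}$ in $\hat{L}_{I}$.
   Context: $(M,g)$ is a smooth $2n$-dimensional manifold with a non-degenerate metric $g$ of arbitrary signature; $\nabla$ is its Levi-Civita connection. Vector fields are sections of the complexified tangent bundle, and $g$, $\nabla$ and the Lie bracket are extended complex-linearly. All results are local: $M$ is replaced by a small open set on which there is a frame $\{e_i,\theta^j\}_{i,j=1}^n$ of the complexified tangent bundle with $g(e_i,e_j)=0$, $g(\theta^i,\theta^j)=0$, $g(e_i,\theta^j)=\frac12\delta_i^j$. Let $V=\mathrm{Span}\{e_i\}$, and identify $\mathrm{Span}\{\theta^j\}$ with the dual bundle $V^*$ via $\theta^j(e_i)=\delta^j_i$. The spinor bundle is $S=\wedge V^*$ with Clifford action $(e+\theta)\cdot\hat\varphi=e\lrcorner\hat\varphi+\theta\wedge\hat\varphi$ for $e\in V,\theta\in V^*$; thus $(vu+uv)\cdot\hat\varphi=2g(v,u)\hat\varphi$. A spinorial connection is a connection $\hat\nabla$ on $S$ satisfying the Leibniz rule $\hat\nabla_X(v\cdot\hat\varphi)=(\nabla_Xv)\cdot\hat\varphi+v\cdot\hat\nabla_X\hat\varphi$ for all vector fields $X,v$ and spinor fields $\hat\varphi$ (no compatibility with an inner product on $S$ is required). An isotropic distribution $I$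 is a smooth constant-rank subbundle of the complexified tangent bundle with $g(v,v)=0$ for all $v\in I$. Its associated pure subspace is the subbundle $\hat L_I=\{\hat\varphi\in S: v\cdot\hat\varphi=0\ \forall v\in I\}$ of $S$. $I$ is integrable if it is closed under Lie brackets: $[X,Y]\in I$ for all vector fields $X,Y$ in $I$. *)

(* Defs.v *)
(* The manifold is a coordinate domain: an open set U of R^(2n), with 2n written
   n + n.  Tensor fields are total functions on R^(2n), constrained and compared
   only on U. *)
From mathcomp Require Import all_boot all_order all_algebra.
From mathcomp Require Import complex.
From mathcomp Require Import all_classical all_reals.
From mathcomp Require Import topology normedtype derive.

Set Implicit Arguments.
Unset Strict Implicit.
Unset Printing Implicit Defensive.

Import Order.TTheory GRing.Theory Num.Theory.
Import numFieldNormedType.Exports.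
Local Open Scope classical_set_scope.
Local Open Scope complex_scope.
Local Open Scope ring_scope.

Section Smooth.
Variables (R : realType) (m : nat).
Implicit Types (U : set 'rV[R]_m) (x : 'rV[R]_m).

Definition partial (i : 'I_m) (f : 'rV[R]_m -> R) : 'rV[R]_m -> R :=
  fun x => 'D_(delta_mx 0 i) f x.

Fixpoint Ck U (k : nat) (f : 'rV[R]_m -> R) : Prop :=
  match k with
  | 0 => forall x, U x -> {for x, continuous f}
  | k'.+1 =>
      (forall (i : 'I_m) x, U x -> derivable f x (delta_mx 0 i)) /\
      (forall i : 'I_m, Ck U k' (partial i f))
  end.

Definition smooth U (f : 'rV[R]_m -> R) : Prop := forall k, Ck U k f.

Definition smoothC U (f : 'rV[R]_m -> R[i]) : Prop :=
  smooth U (fun x => complex.Re (f x)) /\ smooth U (fun x => complex.Im (f x)).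

Definition smooth_vf U (X : 'rV[R]_m -> 'rV[R]_m) : Prop :=
  forall i, smooth U (fun x => X x 0 i).

Definition smooth_vfC U (X : 'rV[R]_m -> 'rV[R[i]]_m) : Prop :=
  forall i, smoothC U (fun x => X x 0 i).

Definition partialC (i : 'I_m) (f : 'rV[R]_m -> R[i]) : 'rV[R]_m -> R[i] :=
  fun x => partial i (fun y => complex.Re (f y)) x
           +i* partial i (fun y => complex.Im (f y)) x.

Definition lie_der (X : 'rV[R]_m -> 'rV[R]_m) (f : 'rV[R]_m -> R) :
    'rV[R]_m -> R :=
  fun x => \sum_i X x 0 i * partial i f x.

Definition lie_derC (X : 'rV[R]_m -> 'rV[R[i]]_m) (f : 'rV[R]_m -> R[i]) :
    'rV[R]_m -> R[i] :=
  fun x => \sum_i X x 0 i * partialC i f x.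

Definition lie_bracket (X Y : 'rV[R]_m -> 'rV[R]_m) : 'rV[R]_m -> 'rV[R]_m :=
  fun x => \row_k (lie_der X (fun y => Y y 0 k) x
                   - lie_der Y (fun y => X y 0 k) x).

Definition Re_vf (X : 'rV[R]_m -> 'rV[R[i]]_m) : 'rV[R]_m -> 'rV[R]_m :=
  fun x => map_mx (@complex.Re R) (X x).

Definition Im_vf (X : 'rV[R]_m -> 'rV[R[i]]_m) : 'rV[R]_m -> 'rV[R]_m :=
  fun x => map_mx (@complex.Im R) (X x).

(* Complex-bilinear extension of a real bilinear operation on vector fields. *)
Definition complexify
    (B : ('rV[R]_m -> 'rV[R]_m) -> ('rV[R]_m -> 'rV[R]_m) ->
         'rV[R]_m -> 'rV[R]_m)
    (X Y : 'rV[R]_m -> 'rV[R[i]]_m) : 'rV[R]_m -> 'rV[R[i]]_m :=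
  fun x => \row_k
    ((B (Re_vf X) (Re_vf Y) x 0 k - B (Im_vf X) (Im_vf Y) x 0 k)
     +i* (B (Re_vf X) (Im_vf Y) x 0 k + B (Im_vf X) (Re_vf Y) x 0 k)).

Definition lie_bracketC := complexify lie_bracket.

End Smooth.

(* Connections on the trivial bundle with fibre W over U: [smF], [smX], [smS]
   select the smooth scalar functions, vector fields and sections, and [der X f]
   is the derivative X(f).  It is used over R for the tangent bundle and over
   R[i] for the spinor bundle.  Values outside U are irrelevant: multiplying by
   the indicator function of the complement of U, which is smooth on U, shows
   that [nabla X s] on U depends only on X and s on U. *)
Record is_connection (E : Type) (K : fieldType) (T W : lmodType K) (U : set E)
    (smF : (E -> K) -> Prop) (smX : (E -> T) -> Prop) (smS : (E -> W) -> Prop)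
    (der : (E -> T) -> (E -> K) -> E -> K)
    (nabla : (E -> T) -> (E -> W) -> E -> W) : Prop := IsConnection {
  connection_smooth : forall X s, smX X -> smS s -> smS (nabla X s);
  connection_addl : forall X Y s, smX X -> smX Y -> smS s ->
    forall x, U x ->
    nabla (fun y => X y + Y y) s x = nabla X s x + nabla Y s x;
  connection_scalel : forall f X s, smF f -> smX X -> smS s ->
    forall x, U x -> nabla (fun y => f y *: X y) s x = f x *: nabla X s x;
  connection_addr : forall X s t, smX X -> smS s -> smS t ->
    forall x, U x ->
    nabla X (fun y => s y + t y) x = nabla X s x + nabla X t x;
  connection_leibniz : forall X f s, smX X -> smF f -> smS s ->
    forall x, U x ->
    nabla X (fun y => f y *: s y) x = der X f x *: s x + f x *: nabla X s x
}.

Definition bilin (K : fieldType) (m : nat) (G : 'M[K]_m) (u v : 'rV[K]_m) : K :=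
  (u *m G *m v^T) 0 0.

Section Metric.
Variables (R : realType) (m : nat).

(* No signature is prescribed. *)
Definition is_metric (U : set 'rV[R]_m) (g : 'rV[R]_m -> 'M[R]_m) : Prop :=
  (forall i j, smooth U (fun x => g x i j)) /\
  (forall x, U x -> (g x)^T = g x /\ g x \in unitmx).

Definition levi_civita (U : set 'rV[R]_m) (g : 'rV[R]_m -> 'M[R]_m)
    (nabla : ('rV[R]_m -> 'rV[R]_m) -> ('rV[R]_m -> 'rV[R]_m) ->
             'rV[R]_m -> 'rV[R]_m) : Prop :=
  [/\ is_connection U (smooth U) (smooth_vf U) (smooth_vf U) (@lie_der R m)
        nabla,
      (forall X Y, smooth_vf U X -> smooth_vf U Y -> forall x, U x ->
        nabla X Y x - nabla Y X x = lie_bracket X Y x)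
    & (forall X Y Z, smooth_vf U X -> smooth_vf U Y -> smooth_vf U Z ->
        forall x, U x ->
        lie_der X (fun y => bilin (g y) (Y y) (Z y)) x =
        bilin (g x) (nabla X Y x) (Z x) + bilin (g x) (Y x) (nabla X Z x))].

Definition metricC (g : 'rV[R]_m -> 'M[R]_m) (x : 'rV[R]_m)
    (u v : 'rV[R[i]]_m) : R[i] :=
  bilin (map_mx (fun a : R => a%:C) (g x)) u v.

End Metric.

(* The exterior algebra on generators theta^0, ..., theta^(n-1): the coordinate
   of [phi] at J = {j_1 < ... < j_k} is its coefficient on
   theta^(j_1) /\ ... /\ theta^(j_k). *)
Notation ext K n := {ffun {set 'I_n} -> K}.

Section Exterior.
Variables (K : fieldType) (n : nat).
Implicit Types (phi : ext K n) (J : {set 'I_n}).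

Definition ext_sign (j : 'I_n) J : K :=
  (-1) ^+ #|[set k in J | (k < j)%N]|.

(* theta^j /\ phi *)
Definition ext_wedge (j : 'I_n) phi : ext K n :=
  [ffun J : {set 'I_n} =>
    if j \in J then ext_sign j J * phi (J :\ j)%SET else 0].

(* Contraction with the dual basis vector e_i: the antiderivation of degree -1
   that sends theta^j to the Kronecker delta. *)
Definition ext_contract (i : 'I_n) phi : ext K n :=
  [ffun J : {set 'I_n} =>
    if i \in J then 0 else ext_sign i J * phi (i |: J)%SET].

End Exterior.

Section Spinors.
Variables (R : realType) (n : nat).
Local Notation E := 'rV[R]_(n + n).
Local Notation TC := 'rV[R[i]]_(n + n).
Local Notation spinor := (ext R[i] n).
Implicit Types (U : set E) (e theta : 'I_n -> E -> TC) (I : E -> {vspace TC}).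

(* The rows are e_1(x), ..., e_n(x), theta^1(x), ..., theta^n(x). *)
Definition frame_mx e theta (x : E) : 'M[R[i]]_(n + n) :=
  col_mx (\matrix_i e i x) (\matrix_j theta j x).

Definition is_null_frame U (g : E -> 'M[R]_(n + n)) e theta : Prop :=
  [/\ (forall i, smooth_vfC U (e i)), (forall j, smooth_vfC U (theta j)),
      (forall x, U x -> frame_mx e theta x \in unitmx)
    & (forall x i j, U x ->
        [/\ metricC g x (e i x) (e j x) = 0,
            metricC g x (theta i x) (theta j x) = 0
          & metricC g x (e i x) (theta j x) = 2^-1 * (i == j)%:R])].

(* With v = \sum_i a_i e_i(x) + \sum_j b_j theta^j(x), the row
   [v *m invmx (frame_mx e theta x)] is (a, b). *)
Definition clifford e theta (x : E) (v : TC) (phi : spinor) : spinor :=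
  let c := v *m invmx (frame_mx e theta x) in
  \sum_i lsubmx c 0 i *: ext_contract i phi
  + \sum_j rsubmx c 0 j *: ext_wedge j phi.

Definition smooth_spinor U (phi : E -> spinor) : Prop :=
  forall J, smoothC U (fun x => phi x J).

Definition is_spinorial_connection U
    (nabla : (E -> E) -> (E -> E) -> E -> E) e theta
    (nablaS : (E -> TC) -> (E -> spinor) -> E -> spinor) : Prop :=
  is_connection U (smoothC U) (smooth_vfC U) (smooth_spinor U)
    (@lie_derC R (n + n)) nablaS /\
  (forall X v phi, smooth_vfC U X -> smooth_vfC U v -> smooth_spinor U phi ->
    forall x, U x ->
    nablaS X (fun y => clifford e theta y (v y) (phi y)) x =
    clifford e theta x (complexify nabla X v x) (phi x)
    + clifford e theta x (v x) (nablaS X phi x)).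

Definition is_distribution U I : Prop :=
  exists r : nat, forall x, U x ->
    exists W : set E, exists X : 'I_r -> E -> TC,
    [/\ open W, W x, W `<=` U, (forall i, smooth_vfC W (X i))
      & (forall y, W y -> basis_of (I y) [tuple X i y | i < r])].

Definition is_isotropic U (g : E -> 'M[R]_(n + n)) I : Prop :=
  forall x v, U x -> v \in I x -> metricC g x v v = 0.

Definition vf_in U I (X : E -> TC) : Prop :=
  smooth_vfC U X /\ (forall x, U x -> X x \in I x).

Definition integrable U I : Prop :=
  forall X Y, vf_in U I X -> vf_in U I Y ->
    forall x, U x -> lie_bracketC X Y x \in I x.

Definition pure_subspace e theta I (x : E) : set spinor :=
  [set phi | forall v, v \in I x -> clifford e theta x v phi = 0].

Definition spinor_in U e theta I (phi : E -> spinor) : Prop :=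
  smooth_spinor U phi /\ (forall x, U x -> pure_subspace e theta I x (phi x)).

End Spinors.

(* Main.v *)
(* If [phi] annihilates [X] and [Y], then differentiating [X . phi = 0] along
   [Y] and [Y . phi = 0] along [X] and using that the Levi-Civita connection is
   torsion-free gives
     [X . nabla_Y phi - Y . nabla_X phi = [X, Y] . phi].
   So the commutation condition says that [[X, Y]] annihilates the pure subspace
   of [I], and it remains to see that only the vectors of [I] do.  If
   [u_1, ..., u_r] is a basis of [I x] and [v] is not in [I x], the Clifford
   product [v u_1 ... u_r] of independent vectors is a nonzero operator.  The
   spinors [u_1 ... u_r psi] extend to global sections of the pure subspace
   without bump functions: replace [u_i] at the point [y] by its Hermitian
   orthogonal projection to [I y], which depends smoothly on [y]. *)
Require Import Defs.
From HB Require Import structures.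
From mathcomp Require Import all_boot all_order all_algebra.
From mathcomp Require Import complex.
From mathcomp Require Import ring.
From mathcomp Require Import all_classical all_reals.
From mathcomp Require Import topology normedtype derive.
Import GRing.Theory Num.Theory.
Import numFieldNormedType.Exports.
Local Open Scope classical_set_scope.
Local Open Scope ring_scope.

Set Implicit Arguments.
Unset Strict Implicit.
Unset Printing Implicit Defensive.

(** * Clifford modules and the exterior algebra *)

Section CliffordModule.
Variables (K : fieldType) (V : vectType K) (W : lmodType K).
Variables (c : V -> W -> W) (b : V -> V -> K).
Hypothesis c_linearl : forall w, linear (c^~ w).
Hypothesis c_linearr : forall v, linear (c v).
Hypothesis c_anticomm : forall u v w, c u (c v w) + c v (c u w) = b u v *: w.

Let c_w w : {linear V -> W} :=
  HB.pack (c^~ w) (GRing.isLinear.Build K V W *:%R (c^~ w) (c_linearl w)).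
Let c_v v : {linear W -> W} :=
  HB.pack (c v) (GRing.isLinear.Build K W W *:%R (c v) (c_linearr v)).

Let c_r0 v : c v 0 = 0. Proof. exact: (raddf0 (c_v v)). Qed.
Let c_rZ v a w : c v (a *: w) = a *: c v w.
Proof. exact: (linearZ_LR (c_v v)). Qed.
Let c_sum w I r (P : pred I) (F : I -> V) :
  c (\sum_(i <- r | P i) F i) w = \sum_(i <- r | P i) c (F i) w.
Proof. exact: (raddf_sum (c_w w)). Qed.
Let c_lZ w a v : c (a *: v) w = a *: c v w.
Proof. exact: (linearZ_LR (c_w w)). Qed.

(** Moving [u] past one vector orthogonal to it costs one sign, because the anticommutator
    vanishes. *)
Lemma foldr_act_anticomm u (s : seq V) w :
  (forall v, v \in s -> b u v = 0) ->
  c u (foldr c w s) = (-1) ^+ size s *: foldr c (c u w) s.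
Proof.
elim: s => [|v s IHs] /= uv0; first by rewrite expr0 scale1r.
have := c_anticomm u v (foldr c w s); rewrite uv0 ?mem_head // scale0r.
move/eqP; rewrite addr_eq0 => /eqP ->.
rewrite IHs => [|t ts]; last by rewrite uv0 // inE ts orbT.
by rewrite c_rZ exprS mulN1r scaleNr.
Qed.

(* If the vectors [v :: s] are free, the dual vector [w] of [v] satisfies
   [w s = +-s w] and [w v + v w = 1], which recovers the product over [s] from
   products over [v :: s]. *)
Lemma foldr_act_free_neq0 (s : seq V) (w0 : W) :
  (forall f : {scalar V}, exists w, forall v, b w v = f v) ->
  w0 != 0 -> free s -> exists w, foldr c w s != 0.
Proof.
move=> b_nondeg w0_neq0; elim: s => [|v s IHs]; first by exists w0.
move=> free_vs.
have /IHs[w w_neq0] : free s by move: free_vs; rewrite free_cons => /andP[].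
have [u bu] := b_nondeg (coord (in_tuple (v :: s)) ord0).
have buv : b u v = 1.
  rewrite bu.
  exact: (coord_free ord0 ord0 (X := in_tuple (v :: s)) free_vs).
have bus t : t \in s -> b u t = 0.
  move=> ts; have i_lt : ((index t s).+1 < (size s).+1)%N.
    by rewrite ltnS index_mem.
  rewrite bu -[t](nth_index 0 ts).
  exact: (coord_free (Ordinal i_lt) ord0 (X := in_tuple (v :: s)) free_vs).
apply: contrapT => all0.
have {all0}foldr0 t : c v (foldr c t s) = 0.
  by apply/eqP/negPn/negP => t_neq0; apply: all0; exists t.
have := c_anticomm u v (foldr c w s); rewrite buv scale1r foldr0.
(* Up to sign, the second term is again a product over [v :: s], now applied to [c u w], so it
   vanishes too. *)
rewrite foldr_act_anticomm // c_rZ foldr0 scaler0.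
rewrite c_r0 addr0 => w0s.
by rewrite -w0s eqxx in w_neq0.
Qed.

(** Anticommute [u] inwards until it meets its own copy; there twice the square of [c u] is
    [b u u = 0]. *)
Lemma act_foldr_mem0 (s : seq V) u w : (2 : K) != 0 ->
  {in u :: s &, forall x y, b x y = 0} -> u \in s -> c u (foldr c w s) = 0.
Proof.
move=> two_neq0; elim: s => [//|v s IHs] b0; rewrite inE => /orP[/eqP <-|us] /=.
  have := c_anticomm u u (foldr c w s); rewrite b0 ?mem_head // scale0r.
  by rewrite -mulr2n => /eqP; rewrite -scaler_nat scaler_eq0
    (negPf two_neq0) => /eqP.
have := c_anticomm u v (foldr c w s).
rewrite b0 ?inE ?eqxx ?us ?orbT // scale0r IHs //; last first.
  by move=> x y; rewrite !inE => xs ys; apply: b0;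
    rewrite !inE orbCA ?xs ?ys orbT.
by rewrite c_r0 addr0.
Qed.

(** Either the head is a combination of the tail, and each term of the expansion repeats a vector of
    the tail, or the tail itself is dependent. *)
Lemma foldr_act_not_free (s : seq V) w : (2 : K) != 0 ->
  {in s &, forall x y, b x y = 0} -> ~~ free s -> foldr c w s = 0.
Proof.
move=> two_neq0; elim: s => [|v s IHs] b0; first by rewrite nil_free.
have b0s : {in s &, forall x y, b x y = 0}.
  by move=> x y xs ys; rewrite b0 ?inE ?xs ?ys ?orbT.
rewrite free_cons negb_and negbK => /orP[/(coord_span (X := in_tuple s)) ->|].
  rewrite /= c_sum big1 //= => i _.
  rewrite c_lZ act_foldr_mem0 ?scaler0 ?mem_nth //.
  by move=> x y; rewrite !inE => /orP[/eqP->|xs] /orP[/eqP->|ys];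
    rewrite b0s // mem_nth.
by move/IHs => /= ->//; rewrite c_r0.
Qed.

Lemma foldr_act_gt_dim (U : {vspace V}) (s : seq V) w :
  (2 : K) != 0 -> {in U &, forall x y, b x y = 0} ->
  {subset s <= U} -> (\dim U < size s)%N -> foldr c w s = 0.
Proof.
move=> two_neq0 b0 sU dimU; apply: foldr_act_not_free => //.
  by move=> x y /sU xU /sU yU; rewrite b0.
apply: contraL dimU; rewrite -leqNgt /free => /eqP <-.
by apply: dimvS; apply/span_subvP.
Qed.

End CliffordModule.

(** * Canonical anticommutation relations for wedge and contraction *)

Section ExteriorAnticommutation.
Variables (K : fieldType) (n : nat).
Local Notation extR := {ffun {set 'I_n} -> K^o}.
Local Notation wedge := (@ext_wedge K n).
Local Notation contract := (@ext_contract K n).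
Implicit Types (phi : extR) (J : {set 'I_n}) (i j k : 'I_n).

Lemma ext_wedge_linear j : linear (wedge j : extR -> extR).
Proof.
move=> a phi psi; apply/ffunP => J; rewrite !ffunE; case: ifP => _.
  by rewrite mulrDr scalerAr.
by rewrite scaler0 addr0.
Qed.

Lemma ext_contract_linear i : linear (contract i : extR -> extR).
Proof.
move=> a phi psi; apply/ffunP => J; rewrite !ffunE; case: ifP => _.
  by rewrite scaler0 addr0.
by rewrite mulrDr scalerAr.
Qed.

Lemma ext_sign_sqr j J : ext_sign K j J * ext_sign K j J = 1.
Proof. by rewrite /ext_sign -expr2 sqrr_sign. Qed.

(** Inserting [k] raises the number of elements below [j] by one exactly when [k < j]. *)
Lemma ext_signU1 j k J : k \notin J ->
  ext_sign K j (k |: J)%SET = (-1) ^+ (k < j)%N * ext_sign K j J.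
Proof.
move=> kJ; rewrite /ext_sign -exprD; congr (_ ^+ _).
rewrite (cardsD1 k) !inE eqxx /=; congr (_ + _)%N.
apply: eq_card => l; rewrite !inE; have [->|//] := eqVneq l k.
by rewrite (negPf kJ).
Qed.

Lemma ext_signD1 j k J : k \in J ->
  ext_sign K j (J :\ k)%SET = (-1) ^+ (k < j)%N * ext_sign K j J.
Proof.
move=> kJ; rewrite -[in RHS](finset.setD1K kJ) ext_signU1 ?inE ?eqxx //.
by rewrite mulrA -expr2 sqrr_sign mul1r.
Qed.

(** Exactly one of the two comparisons holds. This asymmetry is the source of the sign in all three
    anticommutators. *)
Lemma signr_lt_ltN (i j : 'I_n) : i != j ->
  (-1) ^+ (i < j)%N = - (-1) ^+ (j < i)%N :> K.
Proof. by rewrite -val_eqE; case: ltngtP => //=; rewrite ?opprK. Qed.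

Lemma ext_wedge_anticomm j k phi :
  wedge j (wedge k phi) + wedge k (wedge j phi) = 0 :> extR.
Proof.
apply/ffunP => J; rewrite !ffunE !inE.
(* For [j = k] the second wedge looks for [j] in [J] with [j] already removed. *)
have [<-|jk] := eqVneq j k; first by rewrite /= mulr0 if_same addr0.
case: (boolP (j \in J)) => jJ; case: (boolP (k \in J)) => kJ /=;
  rewrite ?mulr0 ?addr0 //.
rewrite !ext_signD1 // (signr_lt_ltN jk) finset.setDDl.
rewrite [finset.setU _ _]finset.setUC.
rewrite -finset.setDDl !mulrA !mulrN !mulNr.
by ring.
Qed.

Lemma ext_contract_anticomm j k phi :
  contract j (contract k phi) + contract k (contract j phi) = 0 :> extR.
Proof.
apply/ffunP => J; rewrite !ffunE !inE.
have [<-|jk] := eqVneq j k; first by rewrite /= mulr0 if_same addr0.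
case: (boolP (j \in J)) => jJ; case: (boolP (k \in J)) => kJ /=;
  rewrite ?mulr0 ?addr0 //.
rewrite !ext_signU1 // (signr_lt_ltN jk) finset.setUCA.
rewrite !mulrA !mulrN !mulNr.
by ring.
Qed.

(** For [i = j] exactly one of the two terms survives, according to whether [i] lies in [J], and its
    sign appears squared. *)
Lemma ext_contract_wedge i j phi :
  contract i (wedge j phi) + wedge j (contract i phi)
  = (i == j)%:R *: phi :> extR.
Proof.
apply/ffunP => J; rewrite !ffunE !inE.
have [<-|ij] := eqVneq i j.
  rewrite scale1r /=; case: (boolP (i \in J)) => iJ.
    by rewrite finset.setD1K // ext_signD1 // ltnn mul1r mulrA ext_sign_sqr
      mul1r add0r.
  by rewrite finset.setU1K // ext_signU1 // ltnn mul1r mulrA ext_sign_sqr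
    mul1r addr0.
rewrite scale0r /=.
case: (boolP (i \in J)) => iJ /=; first by rewrite mulr0 if_same addr0.
case: (boolP (j \in J)) => jJ /=; last by rewrite mulr0 addr0.
have -> : ((i |: J) :\ j = i |: (J :\ j))%SET.
  by apply/setP => k; rewrite !inE; case: (eqVneq k i) => [->|]; rewrite ?ij.
rewrite ext_signU1 // ext_signD1 // (signr_lt_ltN ij) !mulrA !mulrN !mulNr.
by ring.
Qed.

End ExteriorAnticommutation.

(** * Smooth functions *)

Section SmoothFunctions.
Variables (R : realType) (m : nat).
Implicit Types (U W : set 'rV[R]_m) (f g : 'rV[R]_m -> R).

Lemma open_eq_near U f g x : open U -> {in U, f =1 g} -> U x ->
  {near x, f =1 g}.
Proof.
move=> U_open fg Ux; have := open_nbhs_nbhs (conj U_open Ux).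
by apply: filterS => y Uy; apply: fg; rewrite inE.
Qed.

(** Allows smoothness on [U] to be checked on neighbourhoods where the distribution has a smooth
    basis. *)
Lemma Ck_local k f U :
  (forall x, U x -> exists W, [/\ open W, W x & Ck W k f]) -> Ck U k f.
Proof.
elim: k f => [|k IHk] f Uf; first by move=> x /Uf[W [_ Wx Wf]]; exact: Wf.
split=> [i x /Uf[W [_ Wx [df _]]]|i]; first exact: df.
by apply: IHk => x /Uf[W [Wo Wx [_ Wf]]]; exists W; split=> //; apply: Wf.
Qed.

Lemma smooth_local f U :
  (forall x, U x -> exists W, [/\ open W, W x & smooth W f]) -> smooth U f.
Proof.
move=> Uf k; apply: Ck_local => x /Uf[W [Wo Wx Wf]].
by exists W; split.
Qed.

Lemma partial_eq U i f g : open U -> {in U, f =1 g} ->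
  {in U, partial i f =1 partial i g}.
Proof.
move=> U_open fg x; rewrite inE => Ux; apply: near_eq_derive.
exact: open_eq_near fg Ux.
Qed.

(** On an open set, agreement at the points of [U] is agreement near each of them, so limits and
    derivatives transfer. This absorbs arbitrary values outside [U]. *)
Lemma Ck_eq k U f g : open U -> {in U, f =1 g} -> Ck U k f -> Ck U k g.
Proof.
move=> U_open; elim: k f g => [|k IHk] f g fg.
  move=> Uf x Ux; have fgx := open_eq_near U_open fg Ux.
  have gf : f x = g x by apply: fg; rewrite inE.
  rewrite /prop_for /continuous_at -gf.
  apply: cvg_trans (Uf x Ux). exact: near_eq_cvg fgx.
move=> [df Ukf]; split=> [i x Ux|i].
  exact: (near_eq_derivable (open_eq_near U_open fg Ux) (df i x Ux)).
by apply: IHk (Ukf i); apply: partial_eq.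
Qed.

Lemma smooth_eq U f g : open U -> {in U, f =1 g} -> smooth U f -> smooth U g.
Proof. by move=> U_open fg Uf k; apply: Ck_eq (Uf k). Qed.

Lemma smooth_continuous U f x : smooth U f -> U x -> {for x, continuous f}.
Proof. by move=> Uf; exact: (Uf 0%N x). Qed.

Lemma smooth_derivable U f i x :
  smooth U f -> U x -> derivable f x (delta_mx 0 i).
Proof. by move=> Uf; case: (Uf 1%N) => df _; exact: df. Qed.

Lemma smooth_partial U f i : smooth U f -> smooth U (partial i f).
Proof. by move=> Uf k; have [_ Ufi] := Uf k.+1; exact: Ufi. Qed.

Lemma smooth_cst U (a : R) : smooth U (fun=> a).
Proof.
(* The zero function comes first: it is its own partial derivative, so the induction closes, and
   every constant reduces to it. *)
have Ck0 k : Ck U k (fun=> 0 : R).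
  elim: k => [|k IHk]; first by move=> x _; exact: cst_continuous.
  split=> [i x _|i]; first exact: derivable_cst.
  suff -> : partial i (fun=> 0 : R) = fun=> 0 by exact: IHk.
  by apply/funext => x; exact: derive_cst.
case=> [|k]; first by move=> x _; exact: cst_continuous.
split=> [i x _|i]; first exact: derivable_cst.
suff -> : partial i (fun=> a) = fun=> 0 by exact: Ck0.
by apply/funext => x; exact: derive_cst.
Qed.

Lemma CkD k U f g : open U -> Ck U k f -> Ck U k g ->
  Ck U k (fun x => f x + g x).
Proof.
move=> U_open; elim: k f g => [|k IHk] f g Uf Ug.
  by move=> x Ux; apply: continuousD; [apply: Uf|apply: Ug].
case: Uf Ug => df Uf [dg Ug].
split=> [i x Ux|i]; first by apply: derivableD; [apply: df|apply: dg].
apply: Ck_eq (IHk _ _ (Uf i) (Ug i)) => // x.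
by rewrite inE => Ux; rewrite /partial deriveD //; [apply: df|apply: dg].
Qed.

Lemma smoothD U f g : open U -> smooth U f -> smooth U g ->
  smooth U (fun x => f x + g x).
Proof. by move=> U_open Uf Ug k; apply: CkD. Qed.

Lemma smoothM U f g : open U -> smooth U f -> smooth U g ->
  smooth U (fun x => f x * g x).
Proof.
(* Both factors stay smooth of all orders while [k] decreases: the product rule involves [f] and [g]
   themselves, and [Ck U k.+1] does not list order [k] among its clauses. *)
move=> U_open + + k; elim: k f g => [|k IHk] f g Uf Ug.
  by move=> x Ux; apply: continuousM; apply: smooth_continuous Ux.
split=> [i x Ux|i]; first by apply: derivableM; apply: smooth_derivable Ux.
apply: (@Ck_eq _ _ (fun x => f x * partial i g x + g x * partial i f x)) => //.
  move=> x; rewrite inE => Ux; rewrite /partial deriveM //;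
    exact: smooth_derivable Ux.
by apply: CkD => //; apply: IHk => //; apply: smooth_partial.
Qed.

Lemma smoothN U f : open U -> smooth U f -> smooth U (fun x => - f x).
Proof.
move=> U_open Uf.
apply: smooth_eq (smoothM U_open (smooth_cst U (-1)) Uf) => //.
by move=> x _; rewrite mulN1r.
Qed.

(* The functions [g / f ^+ p], with [g] smooth, are closed under partial
   derivatives. *)
Lemma smooth_divX U f g p : open U -> (forall x, U x -> f x != 0) ->
  smooth U f -> smooth U g -> smooth U (fun x => g x / f x ^+ p).
Proof.
move=> U_open f0 Uf Ug k.
have Ufp q : smooth U (fun x => f x ^+ q).
  elim: q => [|q IHq]; first exact: smooth_cst.
  suff -> : (fun x => f x ^+ q.+1) = (fun x => f x * f x ^+ q).
    exact: smoothM.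
  by apply/funext => x; rewrite exprS.
have fq0 q x : U x -> f x ^+ q != 0 by move=> Ux; rewrite expf_neq0 ?f0.
have dV q i x : U x -> derivable (fun x => (f x ^+ q)^-1) x (delta_mx 0 i).
  by move=> Ux; apply: derivableV; [exact: fq0|exact: smooth_derivable Ux].
elim: k g p Ug => [|k IHk] g p Ug.
  move=> x Ux; apply: continuousM; first exact: smooth_continuous Ux.
  by apply: continuousV; [exact: fq0|exact: smooth_continuous Ux].
split=> [i x Ux|i].
  by apply: derivableM; [exact: smooth_derivable Ux|exact: dV].
(* The numerator that the quotient rule produces over [f ^+ p.+1]. *)
pose h x := partial i g x * f x + (- (p%:R * g x)) * partial i f x.
have Uh : smooth U h.
  apply: smoothD => //; apply: smoothM => //; try exact: smooth_partial.
  by apply: smoothN => //; apply: smoothM => //; apply: smooth_cst.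
apply: Ck_eq (IHk h p.+1 Uh) => // x; rewrite inE => Ux.
have dfx : derivable f x (delta_mx 0 i) by exact: smooth_derivable Ux.
rewrite /partial deriveM //; [|exact: smooth_derivable Ux|exact: dV].
rewrite deriveV //; [|exact: fq0|exact: smooth_derivable Ux].
have -> : (fun y => f y ^+ p) = f ^+ p by apply/funext => y; rewrite fctE.
rewrite deriveX // /h /partial.
have := f0 x Ux; have := fq0 p.-1 x Ux.
(* At [p = 0] the truncated exponent [p.-1] is [0], and the factor [p%:R] removes the derivative of
   the power. *)
case: (p) => [|q] /=.
  move=> _ fx0; rewrite !expr0 !mul0r scale0r !scaler0 expr1 invr1.
  by rewrite oppr0 mul0r addr0 add0r scale1r mulfK.
rewrite !exprS; move: (f x ^+ q) => y y0 fx0.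
rewrite /GRing.scale /=; field.
by rewrite y0.
Qed.

Lemma smoothV U f : open U -> (forall x, U x -> f x != 0) -> smooth U f ->
  smooth U (fun x => (f x)^-1).
Proof.
move=> U_open f0 Uf.
apply: smooth_eq (smooth_divX 1 U_open f0 Uf (smooth_cst U 1)) => // x _.
by rewrite expr1 mul1r.
Qed.

End SmoothFunctions.

(** * Smooth complex-valued and matrix-valued functions *)

Section SmoothComplexFunctions.
Variables (R : realType) (m : nat).
Implicit Types (U W : set 'rV[R]_m) (f g : 'rV[R]_m -> R[i]).

Lemma smoothC_eq U f g : open U -> {in U, f =1 g} -> smoothC U f -> smoothC U g.
Proof.
by move=> U_open fg [Ur Ui]; split; [apply: smooth_eq Ur|apply: smooth_eq Ui];
  move=> // x /fg ->.
Qed.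

Lemma smoothC_local f U :
  (forall x, U x -> exists W, [/\ open W, W x & smoothC W f]) -> smoothC U f.
Proof.
by move=> Uf; split; apply: smooth_local => x /Uf[W [Wo Wx [Wr Wi]]]; exists W.
Qed.

Lemma smoothC_cst U (a : R[i]) : smoothC U (fun=> a).
Proof. by split; apply: smooth_cst. Qed.

Lemma smoothCD U f g : open U -> smoothC U f -> smoothC U g ->
  smoothC U (fun x => f x + g x).
Proof.
move=> U_open [fr fi] [gr gi]; split.
  by apply: smooth_eq (smoothD U_open fr gr) => // x _;
    case: (f x) (g x) => ? ? [].
by apply: smooth_eq (smoothD U_open fi gi) => // x _;
    case: (f x) (g x) => ? ? [].
Qed.

Lemma smoothCM U f g : open U -> smoothC U f -> smoothC U g ->
  smoothC U (fun x => f x * g x).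
Proof.
move=> U_open [fr fi] [gr gi]; split.
  apply: smooth_eq (smoothD U_open (smoothM U_open fr gr)
    (smoothN U_open (smoothM U_open fi gi))) => // x _.
  by case: (f x) (g x) => ? ? [].
apply: smooth_eq (smoothD U_open (smoothM U_open fr gi)
  (smoothM U_open fi gr)) => // x _.
by case: (f x) (g x) => ? ? [].
Qed.

Lemma smoothC_conj U f : open U -> smoothC U f ->
  smoothC U (fun x => conjc (f x)).
Proof.
move=> U_open [fr fi]; split.
  by apply: smooth_eq fr => // x _; case: (f x).
by apply: smooth_eq (smoothN U_open fi) => // x _; case: (f x).
Qed.

(** The inverse of a complex number is its conjugate over its squared modulus, which reduces the
    claim to a real inverse. *)
Lemma smoothCV U f : open U -> (forall x, U x -> f x != 0) -> smoothC U f ->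
  smoothC U (fun x => (f x)^-1).
Proof.
move=> U_open f0 [fr fi].
have n0 x : U x ->
    complex.Re (f x) * complex.Re (f x) + complex.Im (f x) * complex.Im (f x)
    != 0.
  move=> /f0; apply: contra; rewrite -!expr2 paddr_eq0 ?sqr_ge0 //.
  by rewrite !sqrf_eq0 eq_complex.
have Un := smoothV U_open n0
  (smoothD U_open (smoothM U_open fr fr) (smoothM U_open fi fi)).
split.
  by apply: smooth_eq (smoothM U_open fr Un) => // x _; case: (f x).
apply: smooth_eq (smoothN U_open (smoothM U_open fi Un)) => // x _.
by case: (f x).
Qed.

Lemma smoothC_sum U (J : Type) (r : seq J) (P : pred J)
    (F : J -> 'rV[R]_m -> R[i]) : open U -> (forall j, smoothC U (F j)) ->
  smoothC U (fun x => \sum_(j <- r | P j) F j x).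
Proof.
move=> U_open UF; elim: r => [|j r IHr].
  by under eq_fun do rewrite big_nil; apply: smoothC_cst.
under eq_fun do rewrite big_cons; case: (P j) => //.
exact: smoothCD.
Qed.

Lemma smoothC_prod U (J : Type) (r : seq J) (P : pred J)
    (F : J -> 'rV[R]_m -> R[i]) : open U -> (forall j, smoothC U (F j)) ->
  smoothC U (fun x => \prod_(j <- r | P j) F j x).
Proof.
move=> U_open UF; elim: r => [|j r IHr].
  by under eq_fun do rewrite big_nil; apply: smoothC_cst.
under eq_fun do rewrite big_cons; case: (P j) => //.
exact: smoothCM.
Qed.

Definition smooth_mxC U p q (A : 'rV[R]_m -> 'M[R[i]]_(p, q)) :=
  forall i j, smoothC U (fun x => A x i j).

Lemma smooth_mxC_mul U p q s (A : 'rV[R]_m -> 'M[R[i]]_(p, q))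
    (B : 'rV[R]_m -> 'M[R[i]]_(q, s)) : open U ->
  smooth_mxC U A -> smooth_mxC U B -> smooth_mxC U (fun x => A x *m B x).
Proof.
move=> U_open UA UB i j; under eq_fun do rewrite mxE.
by apply: smoothC_sum => // k; apply: smoothCM.
Qed.

Lemma smoothC_det U p (A : 'rV[R]_m -> 'M[R[i]]_p) : open U ->
  smooth_mxC U A -> smoothC U (fun x => \det (A x)).
Proof.
move=> U_open UA; apply: smoothC_sum => // s; apply: smoothCM => //.
  exact: smoothC_cst.
exact: smoothC_prod.
Qed.

(** By Cramer's formula the entries are cofactors divided by a determinant that does not vanish on
    [U]. *)
Lemma smooth_mxC_inv U p (A : 'rV[R]_m -> 'M[R[i]]_p) : open U ->
  (forall x, U x -> A x \in unitmx) -> smooth_mxC U A ->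
  smooth_mxC U (fun x => invmx (A x)).
Proof.
move=> U_open A_unit UA i j.
apply: (@smoothC_eq _ (fun x => (\det (A x))^-1 * \adj (A x) i j)) => //.
  by move=> x; rewrite inE => Ux; rewrite /invmx A_unit // [RHS]mxE.
apply: smoothCM => //.
  by apply: smoothCV => //; apply: smoothC_det.
under eq_fun do rewrite mxE; apply: smoothCM => //; first exact: smoothC_cst.
by apply: smoothC_det => // k l; under eq_fun do rewrite !mxE.
Qed.

End SmoothComplexFunctions.

(** * Hermitian projections to a distribution *)

Section OrthogonalProjection.
Variables (R : realType) (m : nat).
Implicit Types (V : {vspace 'rV[R[i]]_m}) (Q : 'M[R[i]]_m).
Implicit Types (u v w : 'rV[R[i]]_m).

(** [v *m adjmx w] is the standard Hermitian product. Projecting to an isotropic space needs such a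
    definite form, since the metric vanishes there. *)
Definition adjmx p q (A : 'M[R[i]]_(p, q)) : 'M[R[i]]_(q, p) :=
  (map_mx conjc A)^T.

Lemma adjmxM p q r (A : 'M[R[i]]_(p, q)) (B : 'M_(q, r)) :
  adjmx (A *m B) = adjmx B *m adjmx A.
Proof. by rewrite /adjmx map_mxM trmx_mul. Qed.

Lemma mul_adjmx_eq0 v : v *m adjmx v = 0 -> v = 0.
Proof.
move/matrixP/(_ 0 0); rewrite !mxE => /eqP.
under eq_bigr do rewrite !mxE.
rewrite psumr_eq0 => [/allP v0|j _]; last first.
  case: (v 0 j) => a b; rewrite lecE /= !mulrN opprK [b * a]mulrC addNr eqxx.
  by rewrite addr_ge0 // -expr2 sqr_ge0.
apply/rowP => j; rewrite mxE; have := v0 j (mem_index_enum _) => /=.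
by rewrite mulf_eq0 conjc_eq0 orbb => /eqP.
Qed.

(** Matrices act on row vectors from the right. No basis of [V] enters this characterization. *)
Definition is_orthoproj V Q := (forall v, v *m Q \in V) /\
  (forall v w, w \in V -> (v - v *m Q) *m adjmx w = 0).

Lemma orthoproj_id V Q v : is_orthoproj V Q -> v \in V -> v *m Q = v.
Proof.
move=> [QV Qo] vV; apply/esym/eqP; rewrite -subr_eq0; apply/eqP.
by apply: mul_adjmx_eq0; apply: Qo; rewrite rpredB.
Qed.

(** The difference of two images of [v] lies in [V] and is orthogonal to [V], hence to itself. So
    the projection may be computed from any basis. *)
Lemma orthoproj_unique V Q Q' : is_orthoproj V Q -> is_orthoproj V Q' -> Q = Q'.
Proof.
move=> [QV Qo] [QV' Qo']; apply/row_matrixP => i.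
rewrite !rowE; set v := delta_mx 0 i; apply/eqP; rewrite -subr_eq0; apply/eqP.
have wV : v *m Q - v *m Q' \in V by rewrite rpredB.
apply: mul_adjmx_eq0.
have wE : v *m Q - v *m Q' = (v - v *m Q') - (v - v *m Q).
  by rewrite opprB [RHS]addrC addrA subrK.
by rewrite {1}wE mulmxBl Qo' // Qo // subrr.
Qed.

(** The classical projection to the row space of [B], with the inverse Gram matrix in the middle. *)
Definition span_proj r (B : 'M[R[i]]_(r, m)) : 'M[R[i]]_m :=
  adjmx B *m invmx (B *m adjmx B) *m B.

(** If [u] kills the Gram matrix, then [u *m B] has Hermitian norm zero. *)
Lemma gram_unitmx r (B : 'M[R[i]]_(r, m)) :
  row_free B -> B *m adjmx B \in unitmx.
Proof.
move=> B_free; rewrite -row_free_unit -kermx_eq0; apply/rowV0P => u.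
move=> /sub_kermxP uBB; apply: (row_free_inj B_free); rewrite mul0mx.
by apply: mul_adjmx_eq0; rewrite adjmxM mulmxA -(mulmxA u) uBB mul0mx.
Qed.

Section Basis.
Variables (V : {vspace 'rV[R[i]]_m}) (r : nat) (X : r.-tuple 'rV[R[i]]_m).
Hypothesis V_basis : basis_of V X.
Local Notation B := (\matrix_(i < r) X`_i).

Lemma basis_row_free : row_free B.
Proof.
rewrite -kermx_eq0; apply/rowV0P => u /sub_kermxP.
rewrite mulmx_sum_row => uB; apply/rowP => i; rewrite mxE.
have /freeP := basis_free V_basis; apply.
by rewrite -[RHS]uB; apply: eq_bigr => j _; rewrite rowK.
Qed.

Lemma mem_basis_mx (u : 'rV_r) : u *m B \in V.
Proof.
rewrite mulmx_sum_row; apply: rpred_sum => j _; rewrite rowK; apply: rpredZ.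
by rewrite (basis_mem V_basis) // mem_nth // size_tuple.
Qed.

Lemma basis_mxP w : w \in V -> exists u : 'rV_r, w = u *m B.
Proof.
move=> wV; exists (\row_i coord X i w); rewrite mulmx_sum_row.
rewrite {1}(coord_basis V_basis wV).
by apply: eq_bigr => j _; rewrite rowK mxE.
Qed.

Lemma span_proj_basis : is_orthoproj V (span_proj B).
Proof.
split=> [v|v w /basis_mxP[u ->]]; first by rewrite mulmxA mem_basis_mx.
rewrite adjmxM mulmxA mulmxBl !mulmxA -(mulmxA _ B) mulmxKV ?subrr ?mul0mx //.
exact: gram_unitmx basis_row_free.
Qed.

End Basis.

Definition orthoproj V := span_proj (\matrix_(i < \dim V) (vbasis V)`_i).

Lemma orthoprojP V : is_orthoproj V (orthoproj V).
Proof. exact/span_proj_basis/vbasisP. Qed.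

(** [vbasis (I y)] need not vary smoothly with [y]. By uniqueness the projection is also given by
    the smooth frame [X], through products, conjugates and a Gram inverse. *)
Lemma smooth_orthoproj (W : set 'rV[R]_m) (I : 'rV[R]_m -> {vspace 'rV[R[i]]_m})
    r (X : 'I_r -> 'rV[R]_m -> 'rV[R[i]]_m) : open W ->
  (forall i, smooth_vfC W (X i)) ->
  (forall y, W y -> basis_of (I y) [tuple X i y | i < r]) ->
  smooth_mxC W (fun y => orthoproj (I y)).
Proof.
move=> W_open WX X_basis i j.
pose B y := \matrix_(k < r) [tuple X k y | k < r]`_k.
have WB : smooth_mxC W B.
  move=> k l; apply: smoothC_eq (WX k l) => // y _.
  by rewrite mxE -tnth_nth tnth_mktuple.
have WBa : smooth_mxC W (fun y => adjmx (B y)).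
  move=> k l; apply: smoothC_eq (smoothC_conj W_open (WB l k)) => // y _.
  by rewrite /adjmx [RHS]mxE [RHS]mxE.
apply: (@smoothC_eq _ _ _ (fun y => span_proj (B y) i j)) => //.
  move=> y; rewrite inE => Wy; congr fun_of_matrix; apply: orthoproj_unique.
    exact: span_proj_basis (X_basis y Wy).
  exact: orthoprojP.
apply: smooth_mxC_mul => //; apply: smooth_mxC_mul => //.
apply: smooth_mxC_inv => //; last exact: smooth_mxC_mul.
by move=> y Wy; apply: gram_unitmx; apply: basis_row_free (X_basis y Wy).
Qed.

End OrthogonalProjection.

(** * The Clifford action *)

Section CliffordAction.
Variables (R : realType) (n : nat).
Local Notation E := 'rV[R]_(n + n).
Local Notation TC := 'rV[R[i]]_(n + n).
Local Notation spinor := (ext R[i] n).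
Variables (e theta : 'I_n -> E -> TC).
Implicit Types (x : E) (u v w : TC) (phi : spinor) (U : set E).
Local Notation cl := (clifford e theta).

(** One index runs through contractions and then wedges, in the order of the rows of [frame_mx], so
    that all anticommutators are entries of a single block matrix. *)
Definition ext_generator (k : 'I_(n + n)) (phi : spinor) : spinor :=
  match fintype.split k with
  | inl i => ext_contract i phi
  | inr j => ext_wedge j phi
  end.

Lemma ext_generator_linear k : linear (ext_generator k).
Proof.
rewrite /ext_generator; case: fintype.split => i.
  exact: ext_contract_linear.
exact: ext_wedge_linear.
Qed.

HB.instance Definition _ k := GRing.isLinear.Build R[i] spinor spinor *:%R
  (ext_generator k) (ext_generator_linear k).

Lemma ext_generator_anticomm k l phi :
  ext_generator k (ext_generator l phi) + ext_generator l (ext_generator k phi)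
  = (block_mx 0 1%:M 1%:M 0 : 'M_(n + n)) k l *: phi.
Proof.
have lE i psi : ext_generator (lshift n i) psi = ext_contract i psi.
  by rewrite /ext_generator (unsplitK (inl i)).
have rE i psi : ext_generator (rshift n i) psi = ext_wedge i psi.
  by rewrite /ext_generator (unsplitK (inr i)).
case: (split_ordP k) => i ->; case: (split_ordP l) => j ->; rewrite ?(lE, rE).
- by rewrite block_mxEul mxE scale0r ext_contract_anticomm.
- by rewrite block_mxEur mxE ext_contract_wedge.
- by rewrite block_mxEdl mxE addrC ext_contract_wedge eq_sym.
- by rewrite block_mxEdr mxE scale0r ext_wedge_anticomm.
Qed.

Lemma clifford_generatorE x v phi : cl x v phi =
  \sum_k (v *m invmx (frame_mx e theta x)) 0 k *: ext_generator k phi.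
Proof.
rewrite big_split_ord /clifford /=; congr (_ + _); apply: eq_bigr => i _.
  by rewrite mxE /ext_generator (unsplitK (inl i)).
by rewrite mxE /ext_generator (unsplitK (inr i)).
Qed.

Lemma clifford_linearl x phi : linear (fun v => cl x v phi).
Proof.
move=> a u v; rewrite !clifford_generatorE scaler_sumr -big_split /=.
apply: eq_bigr => k _; rewrite mulmxDl -scalemxAl.
by rewrite mxE [in LHS]mxE scalerDl scalerA.
Qed.

Lemma clifford_linearr x v : linear (cl x v).
Proof.
move=> a phi psi; rewrite !clifford_generatorE scaler_sumr -big_split /=.
apply: eq_bigr => k _; rewrite ext_generator_linear.
by rewrite scalerDr !scalerA [a * _]mulrC.
Qed.

(** The hyperbolic pairing in frame coordinates. It is defined without the metric, so the
    anticommutation rule is pure algebra at every [x]; it equals [2 g] on [U]. *)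
Definition clifford_form x u v : R[i] :=
  (u *m invmx (frame_mx e theta x) *m block_mx 0 1%:M 1%:M 0
     *m (v *m invmx (frame_mx e theta x))^T) 0 0.

Lemma clifford_anticomm x u v phi :
  cl x u (cl x v phi) + cl x v (cl x u phi) = clifford_form x u v *: phi.
Proof.
have clcl a b : cl x a (cl x b phi) = \sum_k \sum_l
    ((a *m invmx (frame_mx e theta x)) 0 k *
     (b *m invmx (frame_mx e theta x)) 0 l)
    *: ext_generator k (ext_generator l phi).
  rewrite clifford_generatorE; apply: eq_bigr => k _.
  rewrite clifford_generatorE raddf_sum scaler_sumr.
  by apply: eq_bigr => l _; rewrite /= linearZ_LR scalerA.
rewrite clcl [X in _ + X]clcl [X in _ + X]exchange_big -big_split /=.
rewrite /clifford_form; set a := u *m _; set b := v *m _.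
transitivity (\sum_k \sum_l
    (a 0 k * (block_mx 0 1%:M 1%:M 0 : 'M_(n + n)) k l * b 0 l) *: phi).
  apply: eq_bigr => k _; rewrite -big_split /=; apply: eq_bigr => l _.
  by rewrite [b 0 l * _]mulrC -scalerDr ext_generator_anticomm scalerA mulrAC.
rewrite exchange_big mxE scaler_suml /=; apply: eq_bigr => l _.
rewrite -scaler_suml; congr (_ *: _); rewrite [(a *m _) _ _]mxE.
by rewrite [b^T _ _]mxE mulr_suml.
Qed.

Lemma clifford_form_nondegenerate x (f : {scalar TC}) :
  frame_mx e theta x \in unitmx ->
  exists u, forall v, clifford_form x u v = f v.
Proof.
set F := frame_mx e theta x => F_unit.
pose d := \row_j f (delta_mx 0 j).
pose J : 'M[R[i]]_(n + n) := block_mx 0 1%:M 1%:M 0.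
have JJ : J *m J = 1%:M.
  rewrite mulmx_block !mul0mx !mulmx0 !mulmx1 !add0r !addr0.
  by rewrite -scalar_mx_block.
(* [d *m F^T] lists the values of [f] on the frame. The involution [J] exchanges the two dual
   halves, and [F] turns coordinates back into a vector. *)
exists (d *m F^T *m J *m F) => v.
rewrite /clifford_form -/F -/J mulmxK // trmx_mul trmx_inv.
rewrite -(mulmxA _ J J) JJ mulmx1 !mulmxA mulmxK ?unitmx_tr //.
rewrite mxE [v in RHS]row_sum_delta linear_sum.
by apply: eq_bigr => j _; rewrite linearZ /= !mxE mulrC.
Qed.

Lemma bilinE (m : nat) (G : 'M[R[i]]_m) p q (A : 'M_(p, m)) (B : 'M_(q, m))
    i j :
  (A *m G *m B^T) i j = bilin G (row i A) (row j B).
Proof.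
rewrite /bilin -!row_mul !mxE; apply: eq_bigr => k _.
by rewrite !mxE.
Qed.

Lemma frame_gram U (g : E -> 'M[R]_(n + n)) x : is_metric U g ->
  is_null_frame U g e theta -> U x ->
  let F := frame_mx e theta x in
  F *m map_mx (fun a : R => a%:C%C) (g x) *m F^T
  = 2^-1 *: block_mx 0 1%:M 1%:M 0.
Proof.
move=> [_ g_sym] [_ _ _ frameP] Ux F; set G := map_mx _ _.
have G_sym : G^T = G by rewrite /G matrix.map_trmx (g_sym x Ux).1.
rewrite /F /frame_mx; set A := \matrix_i e i x; set B := \matrix_j theta j x.
have AB : A *m G *m B^T = 2^-1 *: 1%:M.
  apply/matrixP => i j; rewrite bilinE !rowK !mxE.
  by have [_ _] := frameP x i j Ux.
rewrite mul_col_mx tr_col_mx mul_col_row scale_block_mx !scaler0.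
congr block_mx => //.
- by apply/matrixP => i j; rewrite bilinE !rowK mxE; have [] := frameP x i j Ux.
(* The null frame prescribes the pairing in one order only; symmetry of the metric supplies the
   other. *)
- have -> : B *m G *m A^T = (A *m G *m B^T)^T.
    by rewrite !trmx_mul trmxK G_sym mulmxA.
  by rewrite AB linearZ /= trmx1.
- by apply/matrixP => i j; rewrite bilinE !rowK mxE; have [] := frameP x i j Ux.
Qed.

Lemma clifford_form_metric U (g : E -> 'M[R]_(n + n)) x u v : is_metric U g ->
  is_null_frame U g e theta -> U x ->
  clifford_form x u v = 2 * metricC g x u v.
Proof.
move=> g_metric frame Ux; have := frame_gram g_metric frame Ux.
have [_ _ /(_ x Ux) F_unit _] := frame.
rewrite /clifford_form /metricC /bilin.
move: (frame_mx _ _ _) F_unit (map_mx _ _) => F F_unit G /= FGF.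
rewrite -{2}(mulmxKV F_unit u) -{2}(mulmxKV F_unit v).
move: (u *m _) (v *m _) => a b.
have -> : block_mx 0 1%:M 1%:M 0 = 2 *: (F *m G *m F^T).
  by rewrite FGF scalerA mulfV ?scale1r // pnatr_eq0.
by rewrite -scalemxAr -scalemxAl mxE trmx_mul !mulmxA.
Qed.

(** Polarization: isotropy controls only the diagonal, and the form at [u + v] is twice the mixed
    term. *)
Lemma isotropic_clifford_form U (g : E -> 'M[R]_(n + n))
    (I : E -> {vspace TC}) x : is_metric U g ->
  is_null_frame U g e theta -> is_isotropic U g I -> U x ->
  {in I x &, forall u v, clifford_form x u v = 0}.
Proof.
move=> g_metric frame Iiso Ux u v uI vI.
have cl_null w : w \in I x -> clifford_form x w w = 0.
  move=> wI; rewrite (clifford_form_metric _ _ g_metric frame Ux).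
  by rewrite Iiso ?mulr0.
have formDl a b c : clifford_form x (a + b) c
    = clifford_form x a c + clifford_form x b c.
  by rewrite /clifford_form !mulmxDl mxE.
have formDr a b c : clifford_form x a (b + c)
    = clifford_form x a b + clifford_form x a c.
  by rewrite /clifford_form mulmxDl linearD mulmxDr mxE.
have formC : clifford_form x u v = clifford_form x v u.
  rewrite /clifford_form.
  transitivity ((u *m invmx (frame_mx e theta x) *m block_mx 0 1%:M 1%:M 0
     *m (v *m invmx (frame_mx e theta x))^T)^T 0 0); first by rewrite [RHS]mxE.
  by rewrite trmx_mul trmxK trmx_mul tr_block_mx !trmx0 !trmx1 mulmxA.
have := cl_null _ (rpredD uI vI); rewrite formDl !formDr !cl_null //.
rewrite addr0 add0r -formC -mulr2n => /eqP.
by rewrite mulrn_eq0 => /eqP.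
Qed.


End CliffordAction.

(** * Spinorial connections *)

Section SpinorialConnections.
Variables (R : realType) (n : nat).
Local Notation E := 'rV[R]_(n + n).
Local Notation TC := 'rV[R[i]]_(n + n).
Local Notation spinor := (ext R[i] n).
Variables (U : set E) (U_open : open U) (g : E -> 'M[R]_(n + n)).
Variables (e theta : 'I_n -> E -> TC) (frame : is_null_frame U g e theta).
Implicit Types (x : E) (v : TC) (phi : E -> spinor) (X Y : E -> TC).
Local Notation cl := (clifford e theta).

(** The frame coordinates of [X] are smooth because the inverse frame matrix is; wedge and
    contraction only permute components up to constant signs. *)
Lemma smooth_clifford X phi : smooth_vfC U X ->
  smooth_spinor U phi -> smooth_spinor U (fun y => cl y (X y) (phi y)).
Proof.
move=> UX Uphi J; have [Ue Utheta F_unit _] := frame.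
have UF : smooth_mxC U (frame_mx e theta).
  move=> i j; rewrite /frame_mx; case: (split_ordP i) => k ->.
    by apply: smoothC_eq (Ue k j) => // y _; rewrite col_mxEu mxE.
  by apply: smoothC_eq (Utheta k j) => // y _; rewrite col_mxEd mxE.
have Uc : smooth_mxC U (fun y => X y *m invmx (frame_mx e theta y)).
  apply: smooth_mxC_mul => //; last exact: smooth_mxC_inv.
  by move=> i j; rewrite ord1; apply: UX.
pose c y k := (X y *m invmx (frame_mx e theta y)) 0 k.
apply: (@smoothC_eq _ _ _ (fun y =>
    \sum_i c y (lshift n i) *
      (if i \in J then 0 else ext_sign R[i] i J * phi y (i |: J)%SET)
    + \sum_j c y (rshift n j) *
      (if j \in J then ext_sign R[i] j J * phi y (J :\ j)%SET else 0))) => //.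
  move=> y _; rewrite /clifford !ffunE !sum_ffunE.
  by congr (_ + _); apply: eq_bigr => i _; rewrite !ffunE mxE.
by apply: smoothCD => //; apply: smoothC_sum => // i; apply: smoothCM => //;
  try exact: Uc; case: (i \in J); try exact: smoothC_cst;
  apply: smoothCM => //; exact: smoothC_cst.
Qed.

Variables (nabla : (E -> E) -> (E -> E) -> E -> E).
Variables (nabla_LC : levi_civita U g nabla).

(** Torsion-freeness is given for real fields, so it is applied to the four pairs of real and
    imaginary parts. *)
Lemma levi_civita_torsionC X Y x : smooth_vfC U X -> smooth_vfC U Y -> U x ->
  complexify nabla X Y x - complexify nabla Y X x = lie_bracketC X Y x.
Proof.
move=> UX UY Ux; have [_ torsion _] := nabla_LC.
have reS Z : smooth_vfC U Z -> smooth_vf U (Re_vf Z).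
  by move=> UZ i; apply: smooth_eq (UZ i).1 => // y _; rewrite mxE.
have imS Z : smooth_vfC U Z -> smooth_vf U (Im_vf Z).
  by move=> UZ i; apply: smooth_eq (UZ i).2 => // y _; rewrite mxE.
have tor A B k : smooth_vf U A -> smooth_vf U B ->
    lie_bracket A B x 0 k = nabla A B x 0 k - nabla B A x 0 k.
  by move=> UA UB; rewrite -torsion // !mxE.
apply/rowP => k; rewrite [RHS]mxE !tor; try exact: reS; try exact: imS.
rewrite !mxE.
by apply/eqP; rewrite eq_complex /=; apply/andP; split; apply/eqP; ring.
Qed.

Variables (nablaS : (E -> TC) -> (E -> spinor) -> E -> spinor).
Hypothesis nablaS_spinorial : is_spinorial_connection U nabla e theta nablaS.

(* [s] is its own multiple by the indicator function of the complement of [U],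
   which is smooth on [U]. *)
Lemma spinorial_connection_eq0 X (s : E -> spinor) x : smooth_vfC U X ->
  (forall y, U y -> s y = 0) -> U x -> nablaS X s x = 0.
Proof.
move=> UX s0 Ux; have [nablaC _] := nablaS_spinorial.
pose f (y : E) : R[i] := if `[< U y >] then 0 else 1.
have f0 y : U y -> f y = 0 by rewrite /f; case: asboolP.
have Uf : smoothC U f.
  by apply: smoothC_eq (smoothC_cst U 0) => // y; rewrite inE => /f0.
have Us : smooth_spinor U s.
  move=> J; apply: smoothC_eq (smoothC_cst U 0) => // y.
  by rewrite inE => /s0 ->; rewrite ffunE.
have sE : s = fun y => f y *: s y.
  apply/funext => y; rewrite /f; case: asboolP => [/s0 ->|_].
    by rewrite scale0r.
  by rewrite scale1r.
rewrite sE (connection_leibniz nablaC) // f0 // s0 // scale0r scaler0.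
by rewrite addr0.
Qed.

(** Leibniz rule for the section [X . phi]. It vanishes only on [U], which suffices for its
    derivative to vanish there. *)
Lemma clifford_nablaS X Y phi x : smooth_vfC U X ->
  smooth_vfC U Y -> smooth_spinor U phi ->
  (forall y, U y -> cl y (X y) (phi y) = 0) -> U x ->
  cl x (X x) (nablaS Y phi x) = - cl x (complexify nabla Y X x) (phi x).
Proof.
move=> UX UY Uphi Xphi Ux; have [_ leibniz] := nablaS_spinorial.
have := leibniz Y X phi UY UX Uphi x Ux.
rewrite spinorial_connection_eq0 // => /esym/eqP.
by rewrite addrC addr_eq0 => /eqP.
Qed.

Lemma clifford_lie_bracket X Y phi x : smooth_vfC U X ->
  smooth_vfC U Y -> smooth_spinor U phi ->
  (forall y, U y -> cl y (X y) (phi y) = 0) ->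
  (forall y, U y -> cl y (Y y) (phi y) = 0) -> U x ->
  cl x (lie_bracketC X Y x) (phi x) =
  cl x (X x) (nablaS Y phi x) - cl x (Y x) (nablaS X phi x).
Proof.
move=> UX UY Uphi Xphi Yphi Ux; rewrite !clifford_nablaS // opprK.
rewrite -levi_civita_torsionC // -scaleN1r addrC clifford_linearl.
by rewrite scaleN1r.
Qed.

Variables (I : E -> {vspace TC}).
Hypotheses (g_metric : is_metric U g) (I_distr : is_distribution U I).
Hypothesis I_isotropic : is_isotropic U g I.

(** Provides global fields in [I] with any prescribed value in [I x] at [x], since the projection
    fixes [I x]. *)
Lemma vf_in_orthoproj v : vf_in U I (fun y => v *m orthoproj (I y)).
Proof.
split=> [i|y _]; last by have [+ _] := orthoprojP (I y); apply.
have [r distr] := I_distr; apply: smoothC_local => x /distr.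
move=> [W [X [Wo Wx WU WX X_basis]]]; exists W; split=> //.
have WI := smooth_orthoproj Wo WX X_basis.
have Wv : smooth_mxC W (fun=> v) by move=> k l; apply: smoothC_cst.
exact: (smooth_mxC_mul Wo Wv WI).
Qed.

(* Every value [u_1 ... u_r psi], with [u_1, ..., u_r] a basis of [I x], is
   attained by a global section: the product of the projections of the [u_i] to
   [I y] kills [I y], since [r + 1] vectors of [I y] are dependent. *)
Lemma spinor_in_foldr x (psi : spinor) : U x ->
  exists2 phi, spinor_in U e theta I phi &
    phi x = foldr (cl x) psi (vbasis (I x)).
Proof.
move=> Ux; pose u y := [seq v *m orthoproj (I y) | v <- vbasis (I x)].
exists (fun y => foldr (cl y) psi (u y)); last first.
  rewrite /u map_id_in // => v /vbasis_mem vI.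
  exact: orthoproj_id (orthoprojP _) vI.
split=> [|y Uy v vI].
  rewrite /u; elim: (tval _) => [|v s IHs] /=.
    by move=> J; apply: smoothC_cst.
  by apply: smooth_clifford => //; apply: (vf_in_orthoproj v).1.
(* One rank serves all points of [U], so [v :: u y] has exactly one vector more than the dimension
   of [I y]. *)
have dimI z : U z -> \dim (I z) = projT1 (cid I_distr).
  case: cid => r /= distr /distr[W [X [_ Wz _ _ /(_ z Wz) Xb]]].
  by rewrite (size_basis Xb) card_ord.
apply: (@foldr_act_gt_dim _ _ _ (cl y) (clifford_form e theta y) _ _ _
  (I y) (v :: u y)).
- exact: clifford_linearl.
- exact: clifford_linearr.
- exact: clifford_anticomm.
- by rewrite pnatr_eq0.
- exact: isotropic_clifford_form g_metric frame I_isotropic Uy.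
- move=> w; rewrite inE => /orP[/eqP -> //|/mapP[w' _ ->]].
  by have [+ _] := orthoprojP (I y); apply.
- by rewrite /= size_map size_tuple !dimI.
Qed.

Lemma pure_subspace_annihilator x v : U x ->
  (forall phi, spinor_in U e theta I phi -> cl x v (phi x) = 0) -> v \in I x.
Proof.
move=> Ux v0; apply: contrapT => /negP vI.
have [_ _ /(_ x Ux) F_unit _] := frame.
have [psi] : exists psi, foldr (cl x) psi (v :: vbasis (I x)) != 0.
  (* The constant function [1] serves as a nonzero spinor to start from. Since [v] is outside [I x],
     adjoining it to the basis keeps the family free. *)
  apply: (@foldr_act_free_neq0 _ _ _ (cl x) (clifford_form e theta x) _ _
    _ [ffun=> 1]).
  - exact: clifford_linearr.
  - exact: clifford_anticomm.
  - by move=> f; apply: clifford_form_nondegenerate.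
  - apply/eqP => /ffunP/(_ finset.set0); rewrite !ffunE => /eqP.
    by rewrite oner_eq0.
  - have bI := vbasisP (I x).
    by rewrite free_cons (span_basis bI) vI (basis_free bI).
have [phi phi_in phix] := spinor_in_foldr psi Ux.
by rewrite /= -phix v0 // eqxx.
Qed.

End SpinorialConnections.

Theorem theorem2 (R : realType) (n : nat)
  (U : set 'rV[R]_(n + n)) (U_open : open U)
  (g : 'rV[R]_(n + n) -> 'M[R]_(n + n)) (g_metric : is_metric U g)
  (nabla : ('rV[R]_(n + n) -> 'rV[R]_(n + n)) ->
           ('rV[R]_(n + n) -> 'rV[R]_(n + n)) ->
           'rV[R]_(n + n) -> 'rV[R]_(n + n))
  (nabla_LC : levi_civita U g nabla)
  (e theta : 'I_n -> 'rV[R]_(n + n) -> 'rV[R[i]]_(n + n))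
  (frame : is_null_frame U g e theta)
  (nablaS : ('rV[R]_(n + n) -> 'rV[R[i]]_(n + n)) ->
            ('rV[R]_(n + n) -> ext R[i] n) -> 'rV[R]_(n + n) -> ext R[i] n)
  (nablaS_spinorial : is_spinorial_connection U nabla e theta nablaS)
  (I : 'rV[R]_(n + n) -> {vspace 'rV[R[i]]_(n + n)})
  (I_distr : is_distribution U I) (I_isotropic : is_isotropic U g I) :
  integrable U I <->
  (forall X Y phi, vf_in U I X -> vf_in U I Y -> spinor_in U e theta I phi ->
    forall x, U x ->
    clifford e theta x (X x) (nablaS Y phi x) =
    clifford e theta x (Y x) (nablaS X phi x)).
Proof.
have bracket X Y phi x : vf_in U I X -> vf_in U I Y ->
    spinor_in U e theta I phi -> U x ->
    clifford e theta x (lie_bracketC X Y x) (phi x) =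
    clifford e theta x (X x) (nablaS Y phi x)
    - clifford e theta x (Y x) (nablaS X phi x).
  move=> [UX XI] [UY YI] [Uphi phiL] Ux.
  by apply: (clifford_lie_bracket U_open nabla_LC nablaS_spinorial) => // y Uy;
    apply: phiL => //; [apply: XI|apply: YI].
split=> [I_int X Y phi XI YI phiL x Ux|comm X Y XI YI x Ux].
  apply/eqP; rewrite -subr_eq0 -bracket //; apply/eqP.
  exact: phiL.2 Ux _ (I_int X Y XI YI x Ux).
apply: (pure_subspace_annihilator U_open frame g_metric I_distr I_isotropic Ux).
by move=> phi phiL; rewrite bracket // comm // subrr.
Qed.
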